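(* Let $n\ge1$ and let $K=\sum_{i=1}^n X_i$, where $X_1,\dots,X_n$ are i.i.d. Poisson random variables with parameter $\lambda>0$, i.e. $\Pr\{X_i=k\}=\lambda^k e^{-\lambda}/k!$ for $k=0,1,2,\dots$. Let $[a,b]\subset(0,\infty)$. Suppose that both $L(k)$ and $U(k)$ are monotone functions of the non-negative integer $k$. Then the minimum of $\Pr\{L(K)<\lambda<U(K)\mid\lambda\}$ with respect to $\lambda\in[a,b]$ is attained at the discrete set $$\{a,b\}\cup\{L(k)\in(a,b):k\ge0\}\cup\{U(k)\in(a,b):k\ge0\}.$$
   Context: $\Pr\{E\mid\lambda\}$ denotes the probability of $E$ when the Poisson parameter has value $\lambda$ (not a conditional probability). $L$ and $U$ are real-valued functions of $k$ not depending on $\lambda$. ''Monotone'' means either non-decreasing or non-increasing; $L$ and $U$ need not be monotone in the same direction. *)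

(* Defs.v *)
From HB Require Import structures.
From mathcomp Require Export all_boot all_order all_algebra.
From mathcomp Require Export all_classical all_reals all_analysis.

Set Implicit Arguments.
Unset Strict Implicit.
Unset Printing Implicit Defensive.

Import Order.TTheory GRing.Theory Num.Theory.

Local Open Scope classical_set_scope.
Local Open Scope ring_scope.

Definition monotone_seq (R : realType) (f : nat -> R) : Prop :=
  nondecreasing_seq f \/ nonincreasing_seq f.

Definition mutually_independent d d' (T : measurableType d)
    (T' : measurableType d') (R : realType) (I : finType)
    (P : probability T R) (X : I -> {mfun T >-> T'}) : Prop :=
  forall (J : {set I}) (A : I -> set T'),
    (forall i, measurable (A i)) ->
    P (\bigcap_(i in [set` J]) (X i @^-1` A i)) =
    (\prod_(i in J) P (X i @^-1` A i))%E.

Definition poisson_distributed d (T : measurableType d) (R : realType)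
    (P : probability T R) (lambda : R) (X : {mfun T >-> nat}) : Prop :=
  forall k : nat, P (X @^-1` [set k]) = (poisson_pmf lambda k)%:E.

Definition iid_poisson d (T : measurableType d) (R : realType) (I : finType)
    (P : probability T R) (lambda : R) (X : I -> {mfun T >-> nat}) : Prop :=
  mutually_independent P X /\ forall i, poisson_distributed P lambda (X i).

(* Main.v *)
(* The coverage probability f(l) = P_l(L(K) < l < U(K)) is a countable sum of
   terms (continuous) * (indicator of the open interval ]L k, U k[), hence lower
   semicontinuous, and it attains its minimum over [a, b] at some x.
   As L and U are monotone, S = {k | L k < x < U k} is an interval of integers,
   and l |-> P_l(K \in S) is quasi-concave, so it does not increase when l
   moves away from x in one of the two directions.  Moving right, stop at y, the
   least of b and the values L k >= x: then L k < y < U k implies k \in S,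
   so f(y) <= P_y(K \in S) <= f(x).  The values L k >= x may fail to have a
   minimum only when L decreases to a limit >= x; then f(a) = 0.  Moving left
   is symmetric, with U in the place of L.  No local constancy of f
   is used, so accumulation points of the values of L and U are harmless. *)
Require Import Defs.
From mathcomp Require Import ring lra.

Set Implicit Arguments.
Unset Strict Implicit.
Unset Printing Implicit Defensive.

Import Order.TTheory GRing.Theory Num.Theory.
Import numFieldNormedType.Exports.

Local Open Scope classical_set_scope.
Local Open Scope ring_scope.

(** * Poisson masses and their partial sums as functions of the rate *)

(** Unlike [poisson_pmf], no case distinction on the sign of the rate, so that it is differentiable
    on the whole line. *)
Definition poisson_mass (R : realType) (k : nat) (r : R) : R :=
  r ^+ k / k`!%:R * expR (- r).

(** The bound is strict: this is the probability of values below [m], zero when [m] is 0. *)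
Definition poisson_cdf (R : realType) (m : nat) (r : R) : R :=
  \sum_(k < m) poisson_mass k r.

Lemma poisson_mass_ge0 (R : realType) k (r : R) :
  0 <= r -> 0 <= poisson_mass k r.
Proof.
by move=> r0; rewrite mulr_ge0 ?expR_ge0// mulr_ge0 ?exprn_ge0// invr_ge0 ler0n.
Qed.

(** At [k = 0] the truncated exponent [k.-1] is harmless, since the factor [k%:R] vanishes. *)
Lemma is_derive_poisson_mass (R : realType) k (r : R) :
  is_derive r 1 (@poisson_mass R k)
    (k%:R * (r ^+ k.-1 / k`!%:R * expR (- r)) - poisson_mass k r).
Proof.
have dX : is_derive r 1 (fun x : R => x ^+ k) (k%:R * r ^+ k.-1).
  have := @is_deriveX R R id k r 1 1 (is_derive_id r 1).
  rewrite /GRing.scale/= mulr1; congr is_derive.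
  by apply/funext => x; rewrite fctE.
have dE : is_derive r 1 (fun x : R => expR (- x)) (- expR (- r)).
  have := @is_derive1_comp R expR -%R r (expR (- r)) (-1) _ _.
  by rewrite mulrN1; apply.
rewrite [X in is_derive _ _ X _](_ : _ =
    (k`!%:R^-1 : R) \*: ((fun x : R => x ^+ k) \* (fun x => expR (- x))));
  last first.
  by apply/funext => x; rewrite /poisson_mass /GRing.scale/= mulrAC mulrC.
apply: is_derive_eq.
rewrite /GRing.scale/= /poisson_mass; ring.
Qed.

(** The derivative of mass [k.+1] is mass [k] minus mass [k.+1], so the sum telescopes to its last
    term. *)
Lemma is_derive_poisson_cdf (R : realType) m (r : R) :
  is_derive r 1 (@poisson_cdf R m.+1) (- poisson_mass m r).
Proof.
elim: m => [|m IH].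
  have -> : @poisson_cdf R 1 = poisson_mass 0.
    by apply/funext => x; rewrite /poisson_cdf big_ord1.
  have := is_derive_poisson_mass 0 r.
  by rewrite mul0r add0r.
have -> : @poisson_cdf R m.+2 = poisson_cdf m.+1 + poisson_mass m.+1.
  by apply/funext => x; rewrite /poisson_cdf big_ord_recr.
have dm := is_derive_poisson_mass m.+1 r.
apply: is_derive_eq.
rewrite /poisson_mass /= factS natrM invfM.
have m0 : m.+1%:R != 0 :> R by rewrite pnatr_eq0.
have f0 : m`!%:R != 0 :> R by rewrite pnatr_eq0 -lt0n fact_gt0.
by field; rewrite f0 addrC natr1 m0.
Qed.

Lemma poisson_cdf_nincr (R : realType) m (x y : R) :
  0 <= x -> x <= y -> poisson_cdf m y <= poisson_cdf m x.
Proof.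
move=> x0 xy; case: m => [|m]; first by rewrite /poisson_cdf !big_ord0.
have d z : derivable (@poisson_cdf R m.+1) z 1.
  by have := is_derive_poisson_cdf m z => -[].
apply: (@ler0_derive1_nincry R _ 0) => // [z|].
  rewrite in_itv/= andbT => z0; rewrite derive1E.
  have := is_derive_poisson_cdf m z => -[_ ->].
  by rewrite oppr_le0 poisson_mass_ge0// ltW.
apply: continuous_subspaceT => z.
exact/differentiable_continuous/derivable1_diffP.
Qed.

(* The derivative of the mass of the window r < k <= q is
   poisson_mass r x - poisson_mass q x, whose sign is that of
   q`! / r`! - x ^+ (q - r): it changes at most once, from + to -. *)
Lemma poisson_window_quasiconcave (R : realType) r q (x : R) :
  (r <= q)%N -> 0 < x ->
  let g y := poisson_cdf q.+1 y - poisson_cdf r.+1 y in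
  (forall y, x <= y -> g y <= g x) \/ (forall y, 0 < y <= x -> g y <= g x).
Proof.
move=> rq x0 g.
have dg (z : R) : is_derive z 1 g (poisson_mass r z - poisson_mass q z).
  have dq := is_derive_poisson_cdf q z; have dr := is_derive_poisson_cdf r z.
  rewrite [g](_ : _ = @poisson_cdf R q.+1 - @poisson_cdf R r.+1)//.
  by apply: is_derive_eq; rewrite opprK addrC.
have d (z : R) : derivable g z 1 by have [] := dg z.
have dgE (z : R) : 0 <= z -> (g : R -> R)^`()%classic z =
      poisson_mass r z * (1 - z ^+ (q - r) * r`!%:R / q`!%:R).
  move=> z0; rewrite derive1E; have [_ ->] := dg z.
  rewrite mulrBr mulr1; congr (_ - _).
  rewrite /poisson_mass -{1}(subnK rq) exprD.
  have f0 : r`!%:R != 0 :> R by rewrite pnatr_eq0 -lt0n fact_gt0.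
  have f1 : q`!%:R != 0 :> R by rewrite pnatr_eq0 -lt0n fact_gt0.
  by field; rewrite f0 f1.
have cg A : {within A, continuous g}.
  apply: continuous_subspaceT => z.
  exact/differentiable_continuous/derivable1_diffP.
have fge0 : 0 <= r`!%:R / q`!%:R :> R by rewrite divr_ge0.
(* The compared quantity is nondecreasing in the rate, so its position relative to 1 at [x] fixes
   the sign of the derivative on all of one side of [x]. *)
have [le1|lt1] := leP (x ^+ (q - r) * r`!%:R / q`!%:R) 1; [right|left].
  move=> y /andP[y0 yx].
  apply: (@ger0_derive1_ndecr R g 0 x) => //; last exact: ltW.
  move=> z; rewrite in_itv/= => /andP[z0 zx]; rewrite dgE; last exact: ltW.
  rewrite mulr_ge0 ?poisson_mass_ge0 ?(ltW z0)// subr_ge0.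
  apply: le_trans le1; rewrite -!mulrA ler_wpM2r// lerXn2r ?nnegrE// ltW//.
move=> y xy.
apply: (@ler0_derive1_nincry R g x) => // z.
rewrite in_itv/= andbT => xz; rewrite dgE; last exact: ltW (lt_trans x0 xz).
have z0 := lt_trans x0 xz.
rewrite mulr_ge0_le0 ?poisson_mass_ge0 ?(ltW z0)// subr_le0.
apply: le_trans (ltW lt1) _; rewrite -!mulrA ler_wpM2r//.
by rewrite lerXn2r ?nnegrE// ltW.
Qed.

(** * The law of a sum of i.i.d. Poisson variables *)

Lemma measurable_fun_sum_nat d (T : measurableType d) (I : Type) (s : seq I)
    (X : I -> {mfun T >-> nat}) :
  measurable_fun setT (fun w => \sum_(i <- s) X i w)%N.
Proof.
elim: s => [|i s IH].
  by under eq_fun do rewrite big_nil; exact: measurable_cst.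
under eq_fun do rewrite big_cons.
exact: measurable_realfun.measurable_fun_addn.
Qed.

Lemma measurable_preimage_nat d (T : measurableType d) (K : T -> nat)
    (S : set nat) : measurable_fun setT K -> measurable (K @^-1` S).
Proof. by move=> mK; rewrite -[_ @^-1` _]setTI; exact: mK. Qed.

(** Boundedness of [K] on [E] keeps the sum finite, so finite additivity suffices. *)
Lemma measure_partition_nat d (T : measurableType d) (R : realType)
    (P : probability T R) (K : T -> nat) (E : set T) n :
  measurable_fun setT K -> measurable E -> E `<=` [set w | (K w < n)%N] ->
  P E = (\sum_(j < n) P (E `&` K @^-1` [set (j : nat)]))%E.
Proof.
move=> mK mE Kn.
pose F j := E `&` K @^-1` [set j].
rewrite -(@measure_bigsetU _ _ _ P F).
- rewrite -(bigcup_mkord n F); congr (P _).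
  apply/seteqP; split=> [w Ew|w [j _] []//].
  by exists (K w) => //=; exact: Kn.
- by move=> j; apply: measurableI => //; exact: measurable_preimage_nat.
- apply/trivIsetP => i j _ _ /eqP ij; apply/seteqP.
  by split=> // w [[_ /= Ki] [_ /= Kj]]; apply: ij; rewrite -Ki -Kj.
Qed.

(** Binomial theorem, with the binomial coefficient cancelled against [k!]: Poisson laws convolve by
    adding rates. *)
Lemma poisson_massD (R : realType) k (x y : R) :
  poisson_mass k (x + y) =
  \sum_(j < k.+1) poisson_mass (k - j) x * poisson_mass j y.
Proof.
rewrite /poisson_mass opprD expRD exprDn !mulr_suml; apply: eq_bigr => j _.
have jk : (j <= k)%N by rewrite -ltnS.
rewrite -(bin_fact jk) !natrM -mulr_natr.
have f0 : j`!%:R != 0 :> R by rewrite pnatr_eq0 -lt0n fact_gt0.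
have f1 : (k - j)`!%:R != 0 :> R by rewrite pnatr_eq0 -lt0n fact_gt0.
have f2 : 'C(k, j)%:R != 0 :> R by rewrite pnatr_eq0 -lt0n bin_gt0.
by field; rewrite f0 f1 f2.
Qed.

(* Carrying along events on the remaining variables makes the induction work
   directly from the product rule: the sum over [s] need not be shown
   independent of the other variables. *)
Lemma iid_poisson_sum_joint d (T : measurableType d) (R : realType)
    (I : finType) (P : probability T R) (X : I -> {mfun T >-> nat}) (l : R)
    (s : seq I) (k : nat) (B : I -> set nat) :
  0 < l -> iid_poisson P l X -> uniq s ->
  P ((fun w => \sum_(i <- s) X i w)%N @^-1` [set k] `&`
     \bigcap_(i in [set i | i \notin s]) X i @^-1` B i) =
  ((poisson_mass k ((size s)%:R * l))%:E *
   \prod_(i | i \notin s) P (X i @^-1` B i))%E.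
Proof.
move=> l0 [ind pX]; elim: s k B => [|i s IH] k B /=.
  move=> _.
  have -> : (fun w => \sum_(i <- [::]) X i w)%N @^-1` [set k] =
            [set _ : T | 0%N = k].
    by apply/seteqP; split=> w /=; rewrite big_nil.
  have := ind [set: I]%SET B (fun _ => Logic.I).
  rewrite (_ : [set` _] = [set i | i \notin [::]]); last first.
    by apply/seteqP; split=> i /=; rewrite ?inE.
  under [in RHS]eq_bigl => i do rewrite inE -[true]/(i \notin [::]).
  (* The empty sum is 0, matching the Poisson law of rate 0: mass 1 at 0 and none elsewhere. *)
  case: k => [|k] E.
    rewrite (_ : [set _ | _] = setT) ?setTI; last by apply/seteqP; split.
    by rewrite E /poisson_mass mul0r oppr0 expR0 expr0 fact0 divr1 mulr1 mul1e.
  rewrite (_ : [set _ | _] = set0) ?set0I; last by apply/seteqP; split=> w /=.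
  by rewrite measure0 /poisson_mass mul0r exprS !mul0r mul0e.
move=> /andP[si us].
set E := _ `&` _.
rewrite (@measure_partition_nat _ _ _ P (X i) E k.+1)//; last first.
- move=> w [/= <- _]; rewrite big_cons ltnS; exact: leq_addr.
- apply: measurableI.
    exact/measurable_preimage_nat/measurable_fun_sum_nat.
  by apply: fin_bigcap_measurable => // i' _; exact: measurable_preimage_nat.
pose Q := (\prod_(i' | i' \notin i :: s) P (X i' @^-1` B i'))%E.
transitivity (\sum_(j < k.+1)
    (poisson_mass (k - j) ((size s)%:R * l) * poisson_mass j l)%:E * Q)%E.
  apply: eq_bigr => j _.
  (* Fixing [X i = j] becomes an event on a variable outside [s], so the induction hypothesis
     applies with total [k - j]. *)
  pose B' i' := if i' == i then [set (j : nat)] else B i'.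
  have B'i : B' i = [set (j : nat)] by rewrite /B' eqxx.
  rewrite (_ : E `&` _ =
     (fun w => \sum_(i <- s) X i w)%N @^-1` [set (k - j)%N] `&`
     \bigcap_(i in [set i | i \notin s]) X i @^-1` B' i); last first.
    apply/seteqP; split=> w; rewrite /E /= big_cons.
      move=> [[Ew Bw] Xj]; split.
        by apply: (@addnI j); rewrite subnKC -?Xj// Xj -ltnS.
      move=> i' /= si'; rewrite /B'; case: eqVneq => [->//|ii'].
      by apply: Bw; rewrite /= inE negb_or ii'.
    move=> [Ew Bw].
    have Xj : X i w = j by have := Bw i si; rewrite B'i.
    split=> //; split; first by rewrite /= Ew Xj subnKC// -ltnS.
    move=> i' /=; rewrite inE negb_or => /andP[ii' si'].
    by have := Bw i' si'; rewrite /B' (negPf ii').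
  rewrite IH// (bigD1 i)//= B'i pX.
  rewrite (eq_bigr (fun i' => P (X i' @^-1` B i'))); last first.
    by move=> i' /andP[_ ii']; rewrite /B' (negPf ii').
  rewrite (eq_bigl (fun i' => i' \notin i :: s)); last first.
    by move=> i'; rewrite inE negb_or andbC.
  by rewrite muleA -EFinM /poisson_pmf l0.
rewrite -ge0_sume_distrl; last first.
  by move=> j _; rewrite lee_fin mulr_ge0// poisson_mass_ge0// ?mulr_ge0// ltW.
rewrite sumEFin; congr (_%:E * _)%E.
rewrite -natr1 mulrDl mul1r poisson_massD; by [].
Qed.

Lemma iid_poisson_sum d (T : measurableType d) (R : realType) n
    (P : probability T R) (X : 'I_n -> {mfun T >-> nat}) (l : R) k :
  0 < l -> iid_poisson P l X ->
  P ((fun w => \sum_(i < n) X i w)%N @^-1` [set k]) =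
  (poisson_mass k (n%:R * l))%:E.
Proof.
move=> l0 iidX.
(* With all indices summed, no variable remains: the intersection is the whole space and the product
   is 1. *)
have := iid_poisson_sum_joint k (fun=> setT) l0 iidX (index_enum_uniq 'I_n).
rewrite (_ : bigcap _ _ = setT) ?setIT; last by apply/seteqP; split.
rewrite big1 ?mule1; last by move=> i; rewrite mem_index_enum.
by rewrite [index_enum _]unlock -enumT size_enum_ord.
Qed.

(** * Probabilities of integer intervals as functions of the parameter *)

Section PoissonCount.
Context d (T : measurableType d) (R : realType) (K : T -> nat).
Context (mK : measurable_fun setT K).

Section FixedParameter.
Context (P : probability T R) (r : R).
Context (PK : forall k, P (K @^-1` [set k]) = (poisson_mass k r)%:E).

Lemma poisson_prob_lt m :
  P (K @^-1` [set k | (k < m)%N]) = (poisson_cdf m r)%:E.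
Proof.
rewrite (@measure_partition_nat _ _ _ P K _ m)//; last first.
  exact: measurable_preimage_nat.
rewrite /poisson_cdf -sumEFin; apply: eq_bigr => j _; rewrite -PK.
by congr (P _); apply/seteqP; split=> [w []//|w /= ->]; split.
Qed.

Lemma poisson_prob_ge m :
  P (K @^-1` [set k | (m <= k)%N]) = (1 - poisson_cdf m r)%:E.
Proof.
rewrite EFinB -poisson_prob_lt -probability_setC; last first.
  exact: measurable_preimage_nat.
congr (P _); rewrite preimage_setC; congr (_ @^-1` _).
apply/seteqP; split=> k /=; first by rewrite leqNgt => /negP.
by move=> /negP; rewrite -leqNgt.
Qed.

Lemma poisson_prob_window m q : (m <= q)%N ->
  P (K @^-1` [set k | (m <= k < q)%N]) = (poisson_cdf q r - poisson_cdf m r)%:E.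
Proof.
move=> mq; set W := [set k | _].
have : P (K @^-1` [set k | (k < q)%N]) =
    (P (K @^-1` W) + P (K @^-1` [set k | (k < m)%N]))%E.
  rewrite -measureU; try exact: measurable_preimage_nat.
    rewrite -preimage_setU; congr (P (_ @^-1` _)); apply/seteqP; split=> k /=.
      by move=> kq; case: (leqP m k) => mk; [left; rewrite /W/= mk|right].
    by case=> [/andP[]|/leq_trans]//; exact.
  by apply/seteqP; split=> // w [/andP[mk _] /=]; rewrite ltnNge mk.
by rewrite !poisson_prob_lt EFinB => ->; rewrite addeK.
Qed.

End FixedParameter.

Definition order_convex_nat (S : set nat) :=
  forall i j k, (i <= j <= k)%N -> S i -> S k -> S j.

(** A nonempty [S] is determined by its least element and, when bounded, its greatest one. Upper
    ends are exclusive to match [poisson_cdf]. *)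
Lemma order_convex_natP (S : set nat) : order_convex_nat S ->
  [\/ S = set0, exists m, S = [set k | (m <= k)%N] |
      exists m q, (m <= q)%N /\ S = [set k | (m <= k < q.+1)%N]].
Proof.
move=> cS; have [->|/set0P[k0 Sk0]] := eqVneq S set0; first exact: Or31.
have exS : exists k, `[< S k >] by exists k0; exact/asboolP.
case: (ex_minnP exS) => m /asboolP Sm mmin.
have [[q Sq]|unb] := pselect (exists q, forall k, `[< S k >] -> (k <= q)%N).
  case: (ex_maxnP exS Sq) => {}q {Sq}/asboolP Sq qmax.
  apply: Or33; exists m, q; split; first exact/mmin/asboolP.
  apply/seteqP; split=> k /=; last by move=> mkq; exact: cS mkq Sm Sq.
  by move=> Sk; rewrite ltnS mmin ?qmax//; exact/asboolP.
apply: Or32; exists m; apply/seteqP; split=> k /=.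
  by move=> Sk; exact/mmin/asboolP.
(* A gap at [k >= m] would, by convexity, make [k] an upper bound of [S]. *)
move=> mk; apply: contrapT => nSk; apply: unb; exists k => j /asboolP Sj.
rewrite leqNgt; apply/negP => kj; apply: nSk; apply: (cS m k j) => //.
by rewrite mk ltnW.
Qed.

Context (P : R -> probability T R) (c : R).
Context (c0 : 0 < c).
Hypothesis PK : forall l k, 0 < l ->
  P l (K @^-1` [set k]) = (poisson_mass k (c * l))%:E.

(** Upper tails grow with the rate and initial segments shrink, so each has a fixed good direction.
    Only windows with a positive lower end need the sign-change argument. *)
Lemma poisson_prob_quasiconcave (S : set nat) (r : R) :
  order_convex_nat S -> 0 < r ->
  (forall l, r <= l -> (P l (K @^-1` S) <= P r (K @^-1` S))%E) \/
  (forall l, 0 < l <= r -> (P l (K @^-1` S) <= P r (K @^-1` S))%E).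
Proof.
move=> /order_convex_natP cS r0.
have PKl l : 0 < l ->
    forall k, P l (K @^-1` [set k]) = (poisson_mass k (c * l))%:E.
  by move=> l0 k; exact: PK.
have cr0 : 0 < c * r by rewrite mulr_gt0.
case: cS => [->|[m ->]|[[|m] [q [mq ->]]]].
- by left=> l _; rewrite preimage_set0 !measure0.
- right=> l /andP[l0 lr]; rewrite !(poisson_prob_ge (PKl _ _))//.
  by rewrite lee_fin lerB// poisson_cdf_nincr ?mulr_ge0 ?ler_pM2l// ltW.
- left=> l rl; have l0 := lt_le_trans r0 rl.
  rewrite !(poisson_prob_window (PKl _ _))//.
  rewrite lee_fin lerB//; last by rewrite /poisson_cdf !big_ord0.
  by rewrite poisson_cdf_nincr ?(ltW cr0) ?ler_pM2l.
have mqS : (m.+1 <= q.+1)%N by exact: ltnW.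
have [dec|inc] := poisson_window_quasiconcave (ltnW mq) cr0; [left|right] => l.
  move=> rl; have l0 := lt_le_trans r0 rl.
  rewrite !(poisson_prob_window (PKl _ _))// lee_fin.
  by apply: dec; rewrite ler_pM2l.
move=> /andP[l0 lr]; rewrite !(poisson_prob_window (PKl _ _))// lee_fin.
by apply: inc; rewrite mulr_gt0//= ler_pM2l.
Qed.

End PoissonCount.

(** * Lower semicontinuity and existence of a minimum *)

(** If the infimum [m] were not attained, each point would have a neighbourhood where [f] exceeds
    some [y > m]. Compactness, used as near-covering along the filter of right neighbourhoods of
    [m], gives one such [y] for all of [A], a contradiction. *)
Lemma compact_lsc_min (T : topologicalType) (R : realType) (A : set T)
    (f : T -> R) :
  A !=set0 -> compact A -> has_lbound (f @` A) ->
  (forall x, A x -> forall y, y < f x -> \forall z \near x, A z -> y < f z) ->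
  exists2 x, A x & forall z, A z -> f x <= f z.
Proof.
move=> [x0 Ax0] /compact_near_coveringP/near_covering_withinP cA lbA lsc.
pose m := inf (f @` A).
have mle z : A z -> m <= f z by move=> Az; apply: ge_inf => //; exists z.
apply: contrapT => nmin.
have mlt x : A x -> m < f x.
  move=> Ax; rewrite lt_neqAle mle// andbT; apply/eqP => mx; apply: nmin.
  by exists x => // z Az; rewrite -mx mle.
have : \forall y \near m^'+, A `<=` [set z | y < f z].
  apply: (cA R (m^'+)%classic (fun y z => y < f z)) => x Ax.
  have [y my yx] : exists2 y, m < y & y < f x.
    by exists ((m + f x) / 2); have := mlt x Ax; lra.
  have near_lt := lsc x Ax y yx.
  near=> z i => /= Az.
  apply: (@lt_trans _ _ y); last by move: Az; near: z.
  by near: i; exact: nbhs_right_lt.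
move=> near_sub.
have [y []] := filter_ex (filterI (nbhs_right_gt m) near_sub).
move=> my ylb; suff : y <= m by rewrite leNgt my.
apply: lb_le_inf; first by exists (f x0), x0.
by move=> _ [z Az <-]; exact/ltW/ylb.
Unshelve. all: by end_near. Qed.

Lemma continuous_poisson_mass (R : realType) k : continuous (@poisson_mass R k).
Proof.
move=> r; have [d _] := is_derive_poisson_mass k r.
exact/differentiable_continuous/derivable1_diffP.
Qed.

Lemma nearby_strict_bounds (R : realType) (u v x : R) :
  u < x < v -> \forall y \near x, u < y < v.
Proof.
move=> /andP[ux xv]; near=> y; apply/andP; split; near: y.
  exact: lt_nbhsr.
exact: lt_nbhsl.
Unshelve. all: by end_near. Qed.

Section LowerSemicontinuity.
Context d (T : measurableType d) (R : realType) (K : T -> nat).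
Context (mK : measurable_fun setT K).

Lemma poisson_prob_finite (P : probability T R) (r : R) N (p : pred nat) :
  (forall k, P (K @^-1` [set k]) = (poisson_mass k r)%:E) ->
  P (K @^-1` [set k | (k < N)%N && p k]) =
  (\sum_(k < N | p k) poisson_mass k r)%:E.
Proof.
move=> PK; rewrite (@measure_partition_nat _ _ _ P K _ N)//; last 2 first.
- exact: measurable_preimage_nat.
- by move=> w /andP[].
rewrite -sumEFin [RHS]big_mkcond; apply: eq_bigr => j _.
rewrite -preimage_setI; case: ifPn => pj.
  rewrite -PK; congr (P (_ @^-1` _)).
  by apply/seteqP; split=> k /= [] // ->; rewrite ltn_ord pj.
rewrite [X in _ @^-1` X](_ : _ = set0) ?preimage_set0 ?measure0//.
by apply/seteqP; split=> // k /= [/andP[_ pk] kj]; move: pj; rewrite -kj pk.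
Qed.

Context (P : R -> probability T R) (c : R).
Context (PK : forall l k, 0 < l ->
  P l (K @^-1` [set k]) = (poisson_mass k (c * l))%:E).
Context (L U : nat -> R).

Let coverage l := fine (P l (K @^-1` [set k | L k < l < U k])).

(** Truncating to [K < N] loses arbitrarily little at [x] and only lowers the coverage elsewhere, so
    finitely many terms suffice. *)
Lemma poisson_coverage_lsc (x y : R) :
  0 < x -> y < coverage x -> \forall l \near x, y < coverage l.
Proof.
move=> x0 yx.
pose p l k := L k < l < U k.
pose A l N := K @^-1` [set k | (k < N)%N && p l k].
have mA l N : measurable (A l N) by exact: measurable_preimage_nat.
have AE l : \bigcup_N A l N = K @^-1` [set k | L k < l < U k].
  apply/seteqP; split=> [w [N _ /andP[]]//|w pw].
  by exists (K w).+1 => //=; rewrite /A/= ltnS leqnn.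
(* Continuity from below selects an [N] whose truncated coverage at [x] still exceeds [y]. *)
have : fine (P x (A x N)) @[N --> \oo] --> coverage x.
  apply: fine_cvg; rewrite fineK ?fin_num_measure//; last first.
    exact: measurable_preimage_nat.
  rewrite -AE; apply: nondecreasing_cvg_mu => //.
    exact: bigcupT_measurable.
  move=> M N MN; apply/subsetPset => w /andP[wM pw].
  by rewrite /A/= (leq_trans wM).
move=> /cvgr_gt/(_ y yx)/filter_ex[N].
rewrite (poisson_prob_finite _ _ (fun k => PK k x0)) /= => yN.
have cF : \sum_(k < N | p x k) poisson_mass k (c * l) @[l --> x] -->
    \sum_(k < N | p x k) poisson_mass k (c * x).
  apply: (@cvg_big R^o _ _ _ _ (@add_continuous R^o)) => k _.
   apply: continuous_comp; first exact: mulrl_continuous.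
  exact: continuous_poisson_mass.
(* Only indices covered at [x] must stay covered, an open condition; indices newly covered near [x]
   can only help. *)
have near_p : \forall l \near x, forall k : 'I_N, p x k -> p l k.
  apply: (@filter_forall _ _
    (fun k : 'I_N => [set l | p x k -> p l k]) (nbhs x)) => k.
  case: (boolP (p x k)) => [pk|npk].
    by near=> l => _; near: l; exact: nearby_strict_bounds.
  by near=> l.
near=> l.
have l0 : 0 < l by near: l; exact: lt_nbhsr.
apply: (@lt_le_trans _ _ (\sum_(k < N | p x k) poisson_mass k (c * l))).
  by near: l; exact: (cvgr_gt _ cF).
rewrite -lee_fin -(poisson_prob_finite N (p x) (fun k => PK k l0)).
rewrite fineK ?fin_num_measure//; last exact: measurable_preimage_nat.
apply: le_measure; rewrite ?inE; try exact: measurable_preimage_nat.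
move=> w /andP[wN pw].
have : forall k : 'I_N, p x k -> p l k by near: l.
by move=> /(_ (Ordinal wN)); exact.
Unshelve. all: by end_near. Qed.

End LowerSemicontinuity.

(** * Level sets of monotone sequences *)

(** The least value at or above [x] is the first such value if [f] is nondecreasing, the last if
    nonincreasing. The third case covers sequences that never drop below [x], where a least value
    may not exist. *)
Lemma monotone_seq_least_above (R : realType) (f : nat -> R) (x : R) :
  monotone_seq f ->
  [\/ forall k, f k < x,
      exists2 k0, x <= f k0 & forall k, x <= f k -> f k0 <= f k |
      forall k, x <= f k].
Proof.
move=> [f_nd|f_ni].
  have [ex|nex] := pselect (exists k, x <= f k).
    case: (ex_minnP ex) => k0 xk0 kmin.
    by apply: Or32; exists k0 => // k /kmin /f_nd.
  apply: Or31 => k; rewrite ltNge; apply/negP => xk; apply: nex; by exists k.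
have [ex|nex] := pselect (exists k, f k < x); last first.
  apply: Or33 => k; rewrite leNgt; apply/negP => kx; apply: nex; by exists k.
(* The first index below [x] is [k1.+1], so [k1] is the last one at or above [x]. *)
case: (ex_minnP ex) => -[|k1] k1x kmin.
  by apply: Or31 => k; apply: le_lt_trans k1x; exact: f_ni.
apply: Or32; exists k1.
  by rewrite leNgt; apply/negP => /kmin; rewrite ltnn.
move=> k xk; apply: (f_ni); rewrite -ltnS ltnNge; apply/negP => k1k.
by move: xk; rewrite leNgt (le_lt_trans _ k1x)// f_ni.
Qed.

Lemma monotone_seq_greatest_below (R : realType) (f : nat -> R) (x : R) :
  monotone_seq f ->
  [\/ forall k, x < f k,
      exists2 k0, f k0 <= x & forall k, f k <= x -> f k <= f k0 |
      forall k, f k <= x].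
Proof.
move=> mf.
have mNf : monotone_seq (fun k => - f k).
  by case: mf => hf; [right|left] => i j ij; rewrite lerN2 hf.
have [lt|[k0 xk0 kmin]|ge] := monotone_seq_least_above (- x) mNf.
- by apply: Or31 => k; rewrite -ltrN2.
- by apply: Or32; exists k0 => [|k]; rewrite -lerN2// => /kmin; rewrite lerN2.
- by apply: Or33 => k; rewrite -lerN2.
Qed.

(** Each inequality cuts out an initial or a final segment of the integers, whatever the direction
    of monotonicity; intersections of such segments are convex. *)
Lemma monotone_seq_between_convex (R : realType) (L U : nat -> R) (x : R) :
  monotone_seq L -> monotone_seq U ->
  order_convex_nat [set k | L k < x < U k].
Proof.
move=> mL mU i j k /andP[ij jk] /= /andP[Li Ui] /andP[Lk Uk]; apply/andP; split.
  by case: mL => mL; [apply: le_lt_trans Lk|apply: le_lt_trans Li]; exact: mL.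
by case: mU => mU; [apply: lt_le_trans Ui _|apply: lt_le_trans Uk _]; exact: mU.
Qed.

(* [P lambda] is the probability measure when the Poisson parameter has value
   [lambda]; the sample space and the X_i do not depend on it. *)
Theorem theorem3 (R : realType) (d : measure_display) (T : measurableType d)
    (n : nat) (hn : (1 <= n)%N)
    (P : R -> probability T R) (X : 'I_n -> {mfun T >-> nat})
    (hX : forall lambda : R, 0 < lambda -> iid_poisson (P lambda) lambda X)
    (K : T -> nat) (hK : forall w : T, K w = (\sum_(i < n) X i w)%N)
    (a b : R) (ha : 0 < a) (hab : a <= b)
    (L U : nat -> R) (hL : monotone_seq L) (hU : monotone_seq U) :
  exists2 lambda0 : R,
    ([set a; b] `|` [set x | exists2 k : nat, x = L k & a < x < b]
                `|` [set x | exists2 k : nat, x = U k & a < x < b]) lambda0 &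
    forall lambda : R, a <= lambda <= b ->
      (P lambda0 [set w | (L (K w) < lambda0 < U (K w))%R] <=
       P lambda [set w | (L (K w) < lambda < U (K w))%R])%E.
Proof.
have mK : measurable_fun setT K.
  by rewrite (funext hK); exact: measurable_fun_sum_nat.
have PK l k : 0 < l -> P l (K @^-1` [set k]) = (poisson_mass k (n%:R * l))%:E.
  by move=> l0; rewrite (funext hK); exact/iid_poisson_sum/hX.
pose S l := [set k | L k < l < U k].
pose f l := P l (K @^-1` S l).
have fE l : f l = (fine (f l))%:E.
  by rewrite fineK// fin_num_measure//; exact: measurable_preimage_nat.
have n0 : 0 < n%:R :> R by rewrite ltr0n.
set D := _ `|` _.
have [x] : exists2 x, `[a, b]%classic x &
    forall z, `[a, b]%classic z -> fine (f x) <= fine (f z).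
  apply: compact_lsc_min.
  - by exists a; rewrite /= in_itv/= lexx.
  - exact: segment_compact.
  - by exists 0 => _ [z _ <-]; exact/fine_ge0/measure_ge0.
  move=> x /=; rewrite in_itv/= => /andP[ax _] y yx.
  have := poisson_coverage_lsc mK PK (lt_le_trans ha ax) yx.
  by apply: filterS => z yz _.
rewrite /= in_itv/= => /andP[ax xb] xmin.
suff [y Dy fyx] : exists2 y, D y & (f y <= f x)%E.
  exists y => // l lab; apply: (le_trans fyx).
  by rewrite -/(f l) fE (fE l) lee_fin; apply: xmin; rewrite /= in_itv.
have Da : D a by left; left; left.
have Db : D b by left; left; right.
have f0 y : S y = set0 -> (f y <= f x)%E.
  by move=> S0; rewrite /f S0 preimage_set0 measure0 measure_ge0.
have [Dx|nDx] := pselect (D x); first by exists x.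
have xa : a < x.
  by rewrite lt_neqAle ax andbT; apply/eqP => E; apply: nDx; rewrite -E.
have {}xb : x < b.
  by rewrite lt_neqAle xb andbT; apply/eqP => E; apply: nDx; rewrite E.
(* Two moves: enlarge the event from [S y] to [S x] at parameter [y], then pass from [y] to [x] with
   the event frozen. *)
have subf y : S y `<=` S x ->
    (P y (K @^-1` S x) <= P x (K @^-1` S x))%E -> (f y <= f x)%E.
  move=> Sy; apply: le_trans.
  apply: le_measure; rewrite ?inE; try exact: measurable_preimage_nat.
  by move=> w; exact: Sy.
have x0 : 0 < x by exact: lt_trans xa.
have [dec|inc] := poisson_prob_quasiconcave mK n0 PK
  (monotone_seq_between_convex (x := x) hL hU) x0.
- have [Lx|[k0 xk0 kmin]|xL] := monotone_seq_least_above x hL.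
  (* [L] never blocks: every [k] satisfies [L k < x], and [U k > b] implies [U k > x]. *)
  + exists b => //; apply: subf; last exact/dec/ltW.
    by move=> k /andP[_ bU]; rewrite /S/= Lx (lt_trans xb).
  + have [bL|Lb] := leP b (L k0).
      exists b => //; apply: subf; last exact/dec/ltW.
      move=> k /andP[Lb bU]; rewrite /S/= (lt_trans xb bU) andbT ltNge.
      by apply/negP => /kmin; rewrite leNgt (lt_le_trans Lb).
    (* Strictness matters: [L k < L k0] rules out every [k] with [x <= L k], by minimality of
       [L k0]. *)
    exists (L k0); first by left; right; exists k0; rewrite // (lt_le_trans xa).
    apply: subf; last exact: dec.
    move=> k /andP[Lk kU]; rewrite /S/= (le_lt_trans xk0 kU) andbT ltNge.
    by apply/negP => /kmin; rewrite leNgt Lk.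
  (* All values of [L] exceed [a], so the coverage at [a] is zero. *)
  + exists a => //; apply: f0; apply/seteqP; split=> // k /andP[La _].
    by have := lt_trans La xa; rewrite ltNge xL.
(* Moving left, the stopping point is the larger of [a] and the greatest value of [U] at or below
   [x]; if all values of [U] are at most [x], the coverage at [b] is zero. *)
- have [xU|[k0 Uk0 kmax]|Ux] := monotone_seq_greatest_below x hU.
  + exists a => //; apply: subf; last by apply: inc; rewrite ha ltW.
    by move=> k /andP[La _]; rewrite /S/= xU (lt_trans La).
  + have [Ua|aU] := leP (U k0) a.
      exists a => //; apply: subf; last by apply: inc; rewrite ha ltW.
      move=> k /andP[La aU]; rewrite /S/= (lt_trans La xa)/= ltNge.
      by apply/negP => /kmax; rewrite leNgt (le_lt_trans Ua).
    exists (U k0); first by right; exists k0; rewrite // aU (le_lt_trans Uk0).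
    apply: subf; last by apply: inc; rewrite Uk0 (lt_trans ha).
    move=> k /andP[Lk kU]; rewrite /S/= (lt_le_trans Lk Uk0)/= ltNge.
    by apply/negP => /kmax; rewrite leNgt kU.
  + exists b => //; apply: f0; apply/seteqP; split=> // k /andP[_ bU].
    by have := lt_trans xb bU; rewrite ltNge Ux.
Qed.
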